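(* Let $d\ge 1$ be an integer. There exist constants $c_1,c_2>0$, depending only on $d$, such that for all integers $T\ge 1$ the minimum number $N_d(T)$ of cops needed to catch a robber of speed $2$ at time exactly $T$ in $\mathbb{Z}^d$ satisfies $c_1T^{d/2}\le N_d(T)\le c_2T^{d/2}$.
   Context: The fixed-time catching game in $\mathbb{Z}^d$, with prescribed time $T$, is the following perfect information game. Distance on $\mathbb{Z}^d$ is the $l_\infty$ distance. The robber starts at the origin and the cops choose their starting positions in $\mathbb{Z}^d$ (several cops may share a point). In each unit of time the robber first moves to a point at $l_\infty$ distance at most $2$ from his current point (possibly staying put), and then each cop moves to a point at $l_\infty$ distance at most $1$ from its current point (possibly staying put). The cops catch the robber at time $T$ if, after exactly $T$ such units of time, at least one cop is at the same point as the robber (it is irrelevant whether cops are on the robber at any other time). $N_d(T)$ is the minimum number of cops having a strategy that guarantees this against every play of the robber. *)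

(* Defs.v *)
From mathcomp Require Import all_boot all_order all_algebra.
From mathcomp Require Import boolp.

Set Implicit Arguments.
Unset Strict Implicit.
Unset Printing Implicit Defensive.

Import GRing.Theory Num.Theory.
Local Open Scope ring_scope.

Definition point (d : nat) : Type := 'rV[int]_d.

Definition linf_dist (d : nat) (x y : point d) : nat :=
  (\max_(i < d) `|x ord0 i - y ord0 i|)%N.

(* Positions of k labelled cops; several cops may share a point. *)
Definition config (d k : nat) : Type := {ffun 'I_k -> point d}.

(* [reply h p] is the joint move of the cops after the robber has just moved
   to [p], where [h] lists the positions (robber, cops) at times 0, ..., t. *)
Record cop_strategy (d k : nat) : Type := CopStrategy {
  start : config d k;
  reply : seq (point d * config d k) -> point d -> config d k
}.

Definition robber_legal (d T : nat) (r : nat -> point d) : Prop :=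
  r 0%N = 0 /\ forall t, (t < T)%N -> (linf_dist (r t) (r t.+1) <= 2)%N.

Definition cops_legal (d k T : nat) (c : nat -> config d k) : Prop :=
  forall t, (t < T)%N -> forall i, (linf_dist (c t i) (c t.+1 i) <= 1)%N.

Definition follows (d k T : nat) (S : cop_strategy d k)
    (r : nat -> point d) (c : nat -> config d k) : Prop :=
  c 0%N = start S /\
  forall t, (t < T)%N ->
    c t.+1 = reply S (mkseq (fun s => (r s, c s)) t.+1) (r t.+1).

Definition catches_at (d k T : nat) (S : cop_strategy d k) : Prop :=
  forall (r : nat -> point d) (c : nat -> config d k),
    robber_legal T r -> follows T S r c ->
    cops_legal T c /\ exists i, c T i = r T.

Definition cops_suffice (d T k : nat) : Prop :=
  exists S : cop_strategy d k, catches_at T S.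

Lemma linf_distxx (d : nat) (x : point d) : linf_dist x x = 0%N.
Proof. by apply/eqP; rewrite -leqn0; apply/bigmax_leqP => i _; rewrite subrr. Qed.

Lemma robber_coord_le (d T : nat) (r : nat -> point d) (i : 'I_d) :
  robber_legal T r -> forall t, (t <= T)%N -> (`|r t ord0 i| <= t.*2)%N.
Proof.
move=> [r0 rstep]; elim=> [|t IH] ltT; first by rewrite r0 mxE.
have /bigmax_leqP /(_ i isT) step := rstep _ ltT.
rewrite doubleS -addn2.
have -> : r t.+1 ord0 i = r t ord0 i - (r t ord0 i - r t.+1 ord0 i).
  by rewrite opprB addrC subrK.
apply: leq_trans (leq_add (IH (ltnW ltT)) step).
have := leqD_dist (r t ord0 i) 0 (r t ord0 i - r t.+1 ord0 i)%R.
by rewrite subr0 sub0r abszN.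
Qed.

(* One motionless cop on every point that the robber can reach. *)
Lemma cops_suffice_ex (d T : nat) : exists k, `[< cops_suffice d T k >].
Proof.
pose J := {ffun 'I_d -> 'I_(T.*2).*2.+1}.
pose pt (f : J) : point d := \row_i ((f i)%:Z - (T.*2)%:Z).
exists #|J|; apply/asboolP.
pose S : cop_strategy d #|J| :=
  CopStrategy [ffun j => pt (enum_val j)] (fun _ _ => [ffun j => pt (enum_val j)]).
exists S => r c rL [c0 cS].
have cE t : (t <= T)%N -> c t = start S.
  by case: t => [//|t] /cS.
split=> [t tT i|]; first by rewrite (cE t (ltnW tT)) (cE _ tT) linf_distxx.
pose f : J := [ffun i => inord (absz (r T ord0 i + (T.*2)%:Z))].
exists (enum_rank f); rewrite cE // ffunE enum_rankK; apply/rowP => i.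
rewrite mxE ffunE.
have b := robber_coord_le i rL (leqnn T).
have nn : 0 <= r T ord0 i + (T.*2)%:Z.
  rewrite -lerBlDr sub0r; apply: lerNnormlW.
  by rewrite -abszE lez_nat.
rewrite inordK; first by rewrite gez0_abs // addrK.
rewrite ltnS -[leqRHS]addnn.
have := leqD_dist (r T ord0 i) 0 (- (T.*2)%:Z)%R.
rewrite subr0 !opprK add0r absz_nat => /leq_trans; apply.
by rewrite leq_add2r.
Qed.

Definition cop_number (d T : nat) : nat := ex_minn (cops_suffice_ex d T).

(* Main.v *)
Require Import Defs.
From mathcomp Require Import all_boot all_order all_algebra.
From mathcomp Require Import boolp reals exp.
From mathcomp Require Import zify ring lra.

(** Both bounds come from one picture: a cop loses half of its chances, in each
coordinate, whenever the remaining time is divided by 4.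

Lower bound.  Let more than [4 * q] units of time remain.  If the robber runs at
full speed in a diagonal direction [e] of [{-1,1}^d] until [q] units remain,
then in each coordinate the points he can still reach at the end lie in one of
two intervals, according to the sign of [e], and these intervals are further
apart than twice the remaining time, which is the length of the interval the
cop can reach.  So a given cop can still be useful for at most one of the [2^d]
directions, and some direction leaves at most a fraction [2^-d] of the useful
cops useful ([small_fibre]).  Iterating ([robber_evades]), fewer than [2^(d*m)]
cops fail as soon as [T >= (4^m - 1) / 3] ([pow_le_cops]).

Upper bound.  Cops that play the coordinates independently reduce the problem to
dimension one ([cops_suffice_product]), where a multiple of [sqrt T] cops must
suffice.  With [s] units of time left, spread the cops around the robber with
density proportional to [(s + |y|)^(-1/2)] at displacement [y], for
[|y| <= 3 * s]: this is the profile that can be re-formed from itself as [s]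
decreases, whatever the robber does.  Integrating the density, the cop carrying
the label [l] stands at displacement [2 * q * l + l * |l|] with [q = sqrt s] and
[|l| <= q]; when the robber moves at velocity [2 * u], every label decreases at
the rate [u * q'], where [q' = 1 / (2 * q)] is the rate at which [q] decreases,
and a computation gives the cop the velocity [u * (1 - |l|/q) - l/q], which lies
in [[-1, 1]].  Labels start on a grid of constant mesh in an interval of length
of order [sqrt T], and the least nonnegative label at the end belongs to a cop that
never left the interval of admissible labels and that is now at the robber's
point.  To make the bound on the speed exact in discrete time, [sqrt s] is
replaced by the sequence [radius s], which grows slightly faster
([offset_step]). *)

Set Implicit Arguments.
Unset Strict Implicit.
Unset Printing Implicit Defensive.

Import Order.TTheory GRing.Theory Num.Theory.
Local Open Scope ring_scope.

(** * One step of a cop with a given label *)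

(** The displacement cop - robber, as a function of the label [l] and of the
scale [q], where [q ^+ 2] is about the remaining time: the solution of
[|y| + q ^+ 2 = (q + |l|) ^+ 2] with the sign of [l]. *)
Definition offset (q l : rat) : rat := 2 * q * l + l * `|l|.

Lemma offsetN q l : offset q (- l) = - offset q l.
Proof. by rewrite /offset normrN; ring. Qed.

(** The middle expression is the displacement of the cop when the robber moves
by [2 * u].  For [l] and [l - u * e] nonnegative it is, up to terms in [e ^+ 2],
[u * (1 - e) - 2 * e * l * (1 + u)], where [0 <= 2 * e * l <= 1 - 2 * e].  The
excess [e] of [2 * q * e] over 1 is what keeps the velocity below 1 near
[l = 0], and the margin [3 / 2] on [l] is what keeps it above -1 at the other
end despite this excess. *)
Lemma offset_step_ge0 (q e l u : rat) :
  e * (2 * q - 1) = 1 -> 0 < e <= 1 / 3 -> -1 <= u <= 1 ->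
  0 <= l <= q + e - 3 / 2 ->
  -1 <= 2 * u + offset q (l - u * e) - offset (q + e) l <= 1.
Proof.
move=> qe /andP[e0 e1] /andP[u0 u1] /andP[l0 l1].
rewrite /offset (ger0_norm l0).
have el : e * l <= 1 / 2 - e + e ^+ 2.
  have := ler_wpM2l (ltW e0) l1; nra.
have el0 : 0 <= e * l by apply: mulr_ge0 => //; apply: ltW.
have e2 : 0 < e ^+ 2 <= e / 3 by apply/andP; split; nra.
have [h|h] := lerP 0 (l - u * e).
  rewrite (ger0_norm h).
  have -> : 2 * u + (2 * q * (l - u * e) + (l - u * e) * (l - u * e)) -
      (2 * (q + e) * l + l * l) =
      u * (2 - e * (2 * q - 1) - e) - 2 * (e * l) * (1 + u) + e ^+ 2 * u ^+ 2.
    by ring.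
  rewrite qe; set w := e * l in el el0 *.
  have w1 : w * (1 + u) <= (1 / 2 - e + e ^+ 2) * (1 + u).
    by apply: ler_wpM2r => //; lra.
  have w2 : 0 <= w * (1 + u) by apply: mulr_ge0 => //; lra.
  have u2 : 0 <= u ^+ 2 <= 1 by apply/andP; split; nra.
  have eu : 0 <= e ^+ 2 * u ^+ 2 <= e ^+ 2.
    by rewrite mulr_ge0 ?sqr_ge0 //= ler_piMr ?sqr_ge0 //; case/andP: u2.
  apply/andP; split; nra.
(* The label changes sign, so both labels are smaller than [e]. *)
rewrite (ltr0_norm h).
have u_gt0 : 0 < u by nra.
have -> : 2 * u + (2 * q * (l - u * e) + (l - u * e) * - (l - u * e)) -
    (2 * (q + e) * l + l * l) =
    u * (2 - e * (2 * q - 1) - e) - 2 * (e * l) - (l - u * e) ^+ 2 - l ^+ 2.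
  by ring.
rewrite qe.
have l2 : 0 <= l <= e by apply/andP; split; nra.
have sq x : - e <= x <= e -> 0 <= x ^+ 2 <= e ^+ 2.
  move=> /andP[x0 x1]; rewrite sqr_ge0 -subr_ge0 subr_sqr.
  by apply: mulr_ge0; lra.
have ue : u * e <= e by rewrite ler_piMl // ltW.
have s1 : 0 <= (l - u * e) ^+ 2 <= e ^+ 2 by apply: sq; lra.
have s2 : 0 <= l ^+ 2 <= e ^+ 2 by apply: sq; lra.
have e23 : 0 <= u * e <= e by rewrite ue mulr_ge0 // ltW.
apply/andP; split; nra.
Qed.

Lemma offset_step (q e l u : rat) :
  e * (2 * q - 1) = 1 -> 0 < e <= 1 / 3 -> `|u| <= 1 ->
  `|l| <= q + e - 3 / 2 ->
  `|2 * u + offset q (l - u * e) - offset (q + e) l| <= 1.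
Proof.
rewrite !ler_norml => qe e01 u1 /andP[lo hi].
have [l0|/ltW l0] := lerP 0 l.
  by apply: offset_step_ge0 => //; apply/andP; split; lra.
have /andP[h1 h2] : -1 <= 2 * - u + offset q (- l - - u * e)
    - offset (q + e) (- l) <= 1.
  by apply: offset_step_ge0 => //; apply/andP; split; lra.
have E : - l - - u * e = - (l - u * e) by ring.
rewrite E !offsetN in h1 h2; apply/andP; split; lra.
Qed.

(** * The scale of the cops' formation *)

(** A rational substitute for [sqrt s].  The increment is a little larger than
[1 / (2 * radius s)], as [offset_step] requires, and the initial value leaves
room for labels up to [1 / 2] when no time remains. *)
Fixpoint radius (s : nat) : rat :=
  if s is s'.+1 then radius s' + (2 * radius s' - 1)^-1 else 2.

Definition gain (s : nat) : rat := (2 * radius s - 1)^-1.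

Lemma radiusS s : radius s.+1 = radius s + gain s.
Proof. by []. Qed.

Lemma radius_ge2 s : 2 <= radius s.
Proof.
elim: s => // s IH; rewrite radiusS; apply: (le_trans IH).
rewrite lerDl /gain invr_ge0; lra.
Qed.

Lemma gainE s : gain s * (2 * radius s - 1) = 1.
Proof. by rewrite /gain mulVf //; have := radius_ge2 s; lra. Qed.

Lemma gain_bounds s : 0 < gain s <= 1 / 3.
Proof.
have r2 := radius_ge2 s; have g1 := gainE s.
have g0 : 0 < gain s by rewrite /gain invr_gt0; lra.
have : gain s * 3 <= gain s * (2 * radius s - 1).
  by rewrite ler_wpM2l ?(ltW g0) //; lra.
by rewrite g0 /= g1; lra.
Qed.

Lemma radius_sqr_le s : radius s ^+ 2 <= (4 + 2 * s)%:R.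
Proof.
elim: s => [|s IH]; first by rewrite addn0.
have /andP[g0 g1] := gain_bounds s.
rewrite radiusS mulnS addnCA natrD.
have -> : (radius s + gain s) ^+ 2 =
    radius s ^+ 2 + gain s * (2 * radius s - 1) + gain s + gain s ^+ 2 by ring.
rewrite gainE; nra.
Qed.

(** Rounding down the real trajectory of a cop keeps its steps legal. *)
Lemma floor_dist (x y : rat) :
  `|x - y| <= 1 -> (`|Num.floor x - Num.floor y| <= 1)%N.
Proof.
rewrite ler_norml => /andP[lo hi].
have xy : x <= y + 1%:~R by rewrite mulr1z; lra.
have yx : y <= x + 1%:~R by rewrite mulr1z; lra.
have := le_floor xy; have := le_floor yx.
rewrite !floorDrz ?intr_int // intrKfloor.
by move: (Num.floor x) (Num.floor y); lia.
Qed.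

(** [radius 0 = 2], so this says that a label in [[0, 1/5)] at the end puts the
rounded position exactly on the robber: it fixes the mesh of the labels. *)
Lemma offset2_itv l : 0 <= l -> l < 1 / 5 -> 0 <= offset 2 l < 1.
Proof.
by move=> l0 l1; rewrite /offset ger0_norm //; apply/andP; split; nra.
Qed.

Lemma grid_point (x b : rat) : `|x| <= b - 2 ->
  exists i : int, `|i|%N%:R <= 5 * b /\ 0 <= i%:~R / 5 - x < 1 / 5.
Proof.
rewrite ler_norml => /andP[x0 x1]; exists (Num.ceil (5 * x)).
have /andP[] := ceil_itv (5 * x); rewrite intrD mulrN1z.
rewrite natr_absz intr_norm ler_norml.
move: ((Num.ceil (5 * x))%:~R : rat) => z lo hi.
by split; apply/andP; split; lra.
Qed.

(** * The cops' strategy in dimension one *)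

Section OneDimension.
Variables (T : nat) (r : nat -> int).

(** The velocity [u] of the robber, normalised to [[-1, 1]]. *)
Definition half_step (t : nat) : rat := (r t.+1 - r t)%:~R / 2.

(** How much every label has decreased: move [j] leaves [T - j.+1] units of
time, so it costs [half_step j] times the last increment of [radius (T - j)]. *)
Definition drift (t : nat) : rat :=
  \sum_(j < t) half_step j * gain (T - j.+1).

Definition label (i : int) (t : nat) : rat := i%:~R / 5 - drift t.

Definition target (i : int) (t : nat) : int :=
  Num.floor ((r t)%:~R + offset (radius (T - t)) (label i t)).

(** The range of labels for which [offset_step] bounds the speed. *)
Definition in_play (i : int) (t : nat) : bool :=
  `|label i t| <= radius (T - t) - 3 / 2.

(** A cop whose target has become too far stays where it is, so that its moves
are always legal. *)
Fixpoint cop_path (i : int) (t : nat) : int :=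
  if t is t'.+1 then
    if (`|cop_path i t' - target i t'.+1| <= 1)%N then target i t'.+1
    else cop_path i t'
  else target i 0.

Lemma cop_path_step i t : (`|cop_path i t - cop_path i t.+1| <= 1)%N.
Proof. by rewrite /=; case: ifP => //; rewrite subrr. Qed.

Lemma labelS i t : label i t.+1 = label i t - half_step t * gain (T - t.+1).
Proof. by rewrite /label /drift big_ord_recr /=; ring. Qed.

Hypothesis r_step : forall t, (t < T)%N -> (`|r t - r t.+1| <= 2)%N.

Lemma half_step_le1 t : (t < T)%N -> `|half_step t| <= 1.
Proof.
move=> /r_step le2; rewrite /half_step normrM -intr_norm.
have : (`|r t.+1 - r t| <= 2)%R by lia.
rewrite -(ler_int rat) => h.
by rewrite [X in _ * X]ger0_norm //; lra.
Qed.

Lemma radius_sub t : (t < T)%N ->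
  radius (T - t) = radius (T - t.+1) + gain (T - t.+1).
Proof. by move=> tT; rewrite -radiusS -subSn. Qed.

Lemma half_step_gain t : (t < T)%N ->
  `|half_step t * gain (T - t.+1)| <= gain (T - t.+1).
Proof.
move=> tT; have /andP[g0 _] := gain_bounds (T - t.+1).
by rewrite normrM (gtr0_norm g0) ler_piMl ?half_step_le1 // ltW.
Qed.

Lemma drift_le t : (t <= T)%N -> `|drift t| <= radius T - radius (T - t).
Proof.
elim: t => [_|t IH tT]; first by rewrite /drift big_ord0 subn0 subrr normr0.
have -> : drift t.+1 = drift t + half_step t * gain (T - t.+1).
  by rewrite /drift big_ord_recr.
have := IH (ltnW tT); rewrite (radius_sub tT).
have := half_step_gain tT.
have := ler_normD (drift t) (half_step t * gain (T - t.+1)); lra.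
Qed.

(** Labels move no faster than the bound on them shrinks: a cop that is out of
play never comes back, hence one that is in play at the end always was. *)
Lemma in_play_pred i t : (t < T)%N -> in_play i t.+1 -> in_play i t.
Proof.
rewrite /in_play labelS => tT; rewrite (radius_sub tT).
have := half_step_gain tT.
have := ler_normD (label i t - half_step t * gain (T - t.+1))
  (half_step t * gain (T - t.+1)).
rewrite subrK; lra.
Qed.

Lemma target_step i t : (t < T)%N -> in_play i t ->
  (`|target i t - target i t.+1| <= 1)%N.
Proof.
move=> tT; rewrite /in_play (radius_sub tT) => live.
have := offset_step (gainE _) (gain_bounds _) (half_step_le1 tT) live.
rewrite -labelS -(radius_sub tT) ler_norml => /andP[lo hi].
set x := (r t)%:~R + offset (radius (T - t)) (label i t).
set y := (r t.+1)%:~R + offset (radius (T - t.+1)) (label i t.+1).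
have E : 2 * half_step t = (r t.+1)%:~R - (r t)%:~R.
  by rewrite /half_step mulrC divfK // rmorphB.
by apply: floor_dist; rewrite ler_norml /x /y; apply/andP; split; lra.
Qed.

Lemma cop_path_target i t : (t <= T)%N -> in_play i t ->
  cop_path i t = target i t.
Proof.
elim: t => // t IH tT live1; have live := in_play_pred tT live1.
by rewrite /= (IH (ltnW tT) live) target_step.
Qed.

(** The mesh of the labels is the length of the interval that [offset2_itv]
sends to the robber's point, so some label ends there, and [drift_le] bounds its
index. *)
Lemma cop_path_catches : exists i : int,
  `|i|%N%:R <= 5 * radius T /\ cop_path i T = r T.
Proof.
have d_le : `|drift T| <= radius T - 2.
  by have := drift_le (leqnn T); rewrite subnn.
have [i [ile /andP[l0 l1]]] := grid_point d_le.
exists i; split=> //.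
have /andP[y0 y1] := offset2_itv l0 l1.
rewrite cop_path_target // /in_play ?subnn.
  apply: floor_def; rewrite subnn rmorphD /= lerDl ltrD2l y1 andbT.
  exact: y0.
rewrite (ger0_norm l0) -[radius 0]/2; clear -l1.
by move: (label i T) l1 => l; lra.
Qed.

End OneDimension.

(** The cops see only the past of the robber. *)
Lemma cop_path_causal T r r' i t : (forall j, (j <= t)%N -> r j = r' j) ->
  cop_path T r i t = cop_path T r' i t.
Proof.
have tgt u : (forall j, (j <= u)%N -> r j = r' j) ->
    target T r i u = target T r' i u.
  move=> E; rewrite /target E //; congr (Num.floor (_ + offset _ (_ - _))).
  by apply: eq_bigr => j _; rewrite /half_step !E // ltnW.
elim: t => [|t IH] E /=; first exact: tgt.
by rewrite (tgt _ E) IH // => j jt; apply/E/leqW.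
Qed.

(** * The upper bound in every dimension *)

Lemma linf_distP d (x y : point d) n :
  reflect (forall j, (`|x ord0 j - y ord0 j| <= n)%N) (linf_dist x y <= n)%N.
Proof.
apply: (iffP (bigmax_leqP _ _ _)) => [le_n j|le_n j _]; first exact: le_n.
exact: le_n.
Qed.

(** There is one cop for each function from coordinates to one-dimensional cops.
In each coordinate some one-dimensional cop is correct at time [T], and the cop
that selects those is correct in all coordinates at once. *)
Lemma cops_suffice_product d T (K : finType)
    (path : (nat -> int) -> K -> nat -> int) :
  (forall r r' i t, (forall j, (j <= t)%N -> r j = r' j) ->
     path r i t = path r' i t) ->
  (forall r i t, (`|path r i t - path r i t.+1| <= 1)%N) ->
  (forall r, (forall t, (t < T)%N -> (`|r t - r t.+1| <= 2)%N) ->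
     exists i, path r i T = r T) ->
  cops_suffice d T (#|K| ^ d).
Proof.
move=> causal slow catch.
have {1}<- : #|{ffun 'I_d -> K}| = (#|K| ^ d)%N by rewrite card_ffun card_ord.
pose coord (r : nat -> point d) j t := r t ord0 j.
pose cops (r : nat -> point d) t : config d #|{ffun 'I_d -> K}| :=
  [ffun i => \row_j path (coord r j) ((enum_val i : {ffun 'I_d -> K}) j) t].
have cops_causal r r' t : (forall j, (j <= t)%N -> r j = r' j) ->
    cops r t = cops r' t.
  move=> E; apply/ffunP => i; rewrite !ffunE; apply/rowP => j; rewrite !mxE.
  by apply: causal => k kt; rewrite /coord E.
pose S := CopStrategy (cops (fun=> 0) 0%N)
  (fun h p => cops (nth 0 (rcons (map fst h) p)) (size h)).
exists S => r c [r0 rstep] [c0 cstep].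
have cE t : (t <= T)%N -> c t = cops r t.
  case: t => [_|t tT].
    by rewrite c0; apply: cops_causal => j; rewrite leqn0 => /eqP->.
  have replyE h p : reply S h p = cops (nth 0 (rcons (map fst h) p)) (size h).
    by [].
  rewrite cstep // replyE size_mkseq; apply: cops_causal => j jt.
  have -> : map fst (mkseq (fun s => (r s, c s)) t.+1) = mkseq r t.+1.
    by rewrite -map_comp.
  by rewrite -mkseqS nth_mkseq.
split=> [t tT i|].
  rewrite !cE ?(ltnW tT) //; apply/linf_distP => j.
  by rewrite !ffunE !mxE.
have catch1 j : exists i, path (coord r j) i T == r T ord0 j.
  have [|i E] := catch (coord r j); last by exists i; apply/eqP.
  by move=> t /rstep /linf_distP; apply.
exists (enum_rank [ffun j => xchoose (catch1 j)]).
rewrite cE // ffunE enum_rankK; apply/rowP => j.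
by rewrite mxE ffunE; apply/eqP/(xchooseP (catch1 j)).
Qed.

(** The bound on [K] is squared to remain in the natural numbers; [K] is at most
[11 * radius T], and [11 ^ 2 * (4 + 2 * T) <= 27 ^ 2 * T]. *)
Lemma cops_suffice_sqrt d T : (1 <= T)%N ->
  exists K, (K ^ 2 <= 27 ^ 2 * T)%N /\ cops_suffice d T (K ^ d).
Proof.
move=> T1; have r2 := radius_ge2 T; have rs := radius_sqr_le T.
have [n /andP[nlo nhi]] : exists n : nat, n%:R <= 5 * radius T < n.+1%:R.
  by exists (Num.truncn (5 * radius T)); apply: truncn_itv; lra.
pose K := (2 * n).+1; exists K; split.
  rewrite -(ler_nat rat) natrX natrM.
  have T1' : 1 <= T%:R :> rat by rewrite ler1n.
  have : K%:R <= 11 * radius T by rewrite /K -natr1 natrM; lra.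
  have : 0 <= K%:R :> rat by [].
  rewrite natrD natrM in rs.
  set k : rat := K%:R; set t : rat := T%:R in rs T1' * => k0 kr.
  have : k ^+ 2 <= (11 * radius T) ^+ 2 by rewrite lerXn2r // nnegrE; lra.
  rewrite exprMn; nra.
rewrite -[K in (K ^ d)%N]card_ord.
apply: (@cops_suffice_product d T 'I_K
          (fun r i => cop_path T r ((i : nat)%:Z - n%:Z))).
- by move=> r r' i t; apply: cop_path_causal.
- by move=> r i t; apply: cop_path_step.
move=> r /cop_path_catches [i [ilo iE]].
have iln : (`|i| <= n)%N.
  by rewrite -ltnS -(ltr_nat rat); apply: le_lt_trans nhi.
have iK : (`|(i + n%:Z)%R| < K)%N by rewrite /K; lia.
exists (Ordinal iK); rewrite -iE /=; congr cop_path; lia.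
Qed.

(** * The play determined by a strategy and a robber's path *)

Section Play.
Variables (d k T : nat) (S : cop_strategy d k).

Fixpoint history (r : nat -> point d) (t : nat) : seq (point d * config d k) :=
  if t is t'.+1 then
    rcons (history r t') (r t'.+1, reply S (history r t') (r t'.+1))
  else [:: (r 0%N, start S)].

Definition play (r : nat -> point d) (t : nat) : config d k :=
  (last (r 0%N, start S) (history r t)).2.

Lemma history_play r t : history r t = mkseq (fun s => (r s, play r s)) t.+1.
Proof.
elim: t => // t IH; rewrite mkseqS -IH /= /play /=.
by rewrite last_rcons.
Qed.

Lemma play_follows r : follows T S r (play r).
Proof.
by split=> // t _; rewrite -history_play /play /= last_rcons.
Qed.

Lemma play_causal r r' t : (forall j, (j <= t)%N -> r j = r' j) ->
  play r t = play r' t.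
Proof.
move=> E; suff H: history r t = history r' t by rewrite /play H E.
elim: t E => [|t IH] E /=; first by rewrite E.
by rewrite IH ?E // => j jt; apply/E/leqW.
Qed.

End Play.

(** * The robber's evasion *)

Lemma coord_dist (f : nat -> int) (b a n : nat) :
  (forall t, (a <= t < a + n)%N -> (`|f t - f t.+1| <= b)%N) ->
  (`|f a - f (a + n)%N| <= b * n)%N.
Proof.
elim: n => [|n IH] step; first by rewrite addn0 subrr.
have h1 : (`|f a - f (a + n)%N| <= b * n)%N.
  by apply: IH => t /andP[at1 tn]; apply: step; lia.
have h2 : (`|f (a + n)%N - f (a + n).+1| <= b)%N by apply: step; lia.
rewrite addnS; nia.
Qed.

(** The robber needs this much time against fewer than [2 ^ (d * m)] cops: the
step makes each run more than three quarters of the remaining time. *)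
Fixpoint reserve (m : nat) : nat :=
  if m is m'.+1 then (4 * reserve m').+1 else 0.

Lemma reserveE m : (3 * reserve m + 1 = 4 ^ m)%N.
Proof. by elim: m => //= m IH; rewrite expnS; lia. Qed.

(** The path [r] until time [t], then [n] steps of length 2 in every coordinate,
with signs given by [e], then rest. *)
Definition run d (r : nat -> point d) (t n : nat) (e : {ffun 'I_d -> bool})
    (u : nat) : point d :=
  if (u <= t)%N then r u
  else r t + \row_j ((-1) ^+ e j * (2 * minn (u - t) n)%:Z).

Lemma run_legal d T r t n e : (t <= T)%N ->
  @robber_legal d T r -> robber_legal T (run r t n e).
Proof.
move=> tT [r0 rstep]; split=> [|u uT]; first by rewrite /run leq0n.
rewrite /run; have [ut|ut|ut] := ltngtP u t.
- exact: rstep.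
- apply/linf_distP => j; rewrite !mxE.
  by case: (e j); rewrite ?expr0 ?expr1; lia.
- rewrite ut; apply/linf_distP => j; rewrite !mxE opprD addrA subrr sub0r.
  by case: (e j); rewrite ?expr0 ?expr1; lia.
Qed.

Lemma run_end d (r : nat -> point d) t n e j :
  run r t n e (t + n)%N ord0 j = r t ord0 j + (-1) ^+ e j * (2 * n)%:Z.
Proof.
rewrite /run; case: leqP => h; rewrite ?mxE.
  have -> : n = 0%N by lia.
  by rewrite addn0 mulr0 addr0.
by rewrite addKn minnn.
Qed.

(** Pigeonhole: each [i] is in at most one of the sets, so their sizes add up to
at most [#|A|]. *)
Lemma small_fibre (I J : finType) (A : {set I}) (P : J -> pred I) (b : nat) :
  (forall i j j', P j i -> P j' i -> j = j') ->
  (#|A| < #|J| * b)%N -> exists j, (#|[set i in A | P j i]| < b)%N.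
Proof.
move=> disj ltA; apply/existsP; rewrite -[[exists _, _]]negbK.
apply/negP; rewrite negb_exists => /forallP big.
have h1 : (#|J| * b <= \sum_j #|[set i in A | P j i]|)%N.
  by rewrite -sum_nat_const; apply: leq_sum => j _; rewrite leqNgt.
suff : (\sum_j #|[set i in A | P j i]| <= #|A|)%N by lia.
under eq_bigr => j _ do rewrite -sum1dep_card big_mkcondr.
rewrite exchange_big -sum1_card; apply: leq_sum => i _.
rewrite -big_mkcond sum1_card; apply/card_le1_eqP => j j'.
by move=> Pj Pj'; apply: (disj i).
Qed.

(** The statement is local in time and in the set of cops so that the induction
can continue from the end of a run with only the cops that may still catch. *)
Lemma robber_evades d k T (S : cop_strategy d k) : catches_at T S ->
  forall m (r : nat -> point d) (t : nat) (A : {set 'I_k}),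
    robber_legal T r -> (t + reserve m <= T)%N -> (#|A| < 2 ^ (d * m))%N ->
    exists r', [/\ robber_legal T r', forall u, (u <= t)%N -> r' u = r u
      & forall i, i \in A -> play S r' T i <> r' T].
Proof.
move=> catch; elim=> [|m IH] r t A r_legal tm ltA.
  exists r; split=> // i.
  by rewrite muln0 expn0 ltnS leqn0 cards_eq0 in ltA; rewrite (eqP ltA) inE.
pose q := reserve m.
have [n [tn n3]] : exists n, (t + n + q = T)%N /\ (3 * q < n)%N.
  by exists (T - t - q)%N; move: tm; rewrite /= -/q; lia.
(* The cops that may still catch after the run [e]: a cop has [n + q] moves
   left, and the robber will have [q] moves left. *)
pose P (e : {ffun 'I_d -> bool}) (i : 'I_k) := [forall j,
  (`|play S r t i ord0 j - run r t n e (t + n)%N ord0 j| <= (n + q) + 2 * q)%N].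
(* The ends of two different runs are [4 * n] apart in some coordinate, which
   exceeds [2 * (n + 3 * q)]. *)
have disj i e e' : P e i -> P e' i -> e = e'.
  move=> /forallP Pe /forallP Pe'; apply/ffunP => j.
  have := Pe j; have := Pe' j; rewrite !run_end.
  move: (play S r t i ord0 j) (r t ord0 j) => c x.
  by case: (e j) (e' j) => [] []; rewrite ?expr0 ?expr1; lia.
have [|e lte] := @small_fibre _ _ A P (2 ^ (d * m)) disj.
  by rewrite card_ffun card_bool card_ord -expnD -mulnS.
have tT : (t <= T)%N by lia.
have [|r' [r'_legal r'E evade]] :=
  IH _ (t + n)%N _ (run_legal n e tT r_legal) _ lte.
  by rewrite -/q tn.
have r'r u : (u <= t)%N -> r' u = r u.
  by move=> ut; rewrite r'E /run ?ut // (leq_trans ut) ?leq_addr.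
exists r'; split=> // i iA caught.
have [Pi|/negP nPi] := boolP (P e i).
  by apply: (evade i); rewrite // inE iA.
apply: nPi; apply/forallP => j.
(* A cop discarded by [P] that catches would have come too far. *)
have [cops_legal_r' _] := catch r' _ r'_legal (play_follows T S r').
rewrite -(play_causal S r'r) -r'E //.
have hc : (`|play S r' t i ord0 j - play S r' T i ord0 j| <= 1 * (n + q))%N.
  rewrite -{1}tn -addnA; apply: (@coord_dist (fun u => play S r' u i ord0 j)).
  move=> u /andP[_ uT]; apply: (linf_distP _ _ _ (cops_legal_r' u _ i)).
  by rewrite -tn -addnA.
have hr : (`|r' (t + n)%N ord0 j - r' T ord0 j| <= 2 * q)%N.
  rewrite -{1}tn; apply: (@coord_dist (fun u => r' u ord0 j)).
  move=> u /andP[_ uT]; have [_ step] := r'_legal.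
  by apply: (linf_distP _ _ _ (step u _)); rewrite -tn.
rewrite caught in hc.
rewrite mul1n in hc; rewrite distnC in hr.
exact: leq_trans (leqD_dist _ _ _) (leq_add hc hr).
Qed.

Lemma pow_le_cops d T k m : cops_suffice d T k -> (reserve m <= T)%N ->
  (2 ^ (d * m) <= k)%N.
Proof.
move=> [S catch] mT; rewrite leqNgt; apply/negP => ltk.
have still : robber_legal T (fun=> 0 : point d).
  by split=> // t _; rewrite linf_distxx.
have [|r [r_legal _ evade]] :=
  @robber_evades d k T S catch m _ 0%N setT still mT.
  by rewrite cardsT card_ord.
have [_ [i]] := catch r _ r_legal (play_follows T S r).
by apply: evade; rewrite inE.
Qed.

(** * The order of magnitude of the cop number *)

Lemma cop_numberP d T : cops_suffice d T (cop_number d T).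
Proof. by rewrite /cop_number; case: ex_minnP => k /asboolP. Qed.

Lemma cop_number_le d T k : cops_suffice d T k -> (cop_number d T <= k)%N.
Proof.
by move=> kS; rewrite /cop_number; case: ex_minnP => n _; apply; apply/asboolP.
Qed.

Lemma powR_half_nat (R : realType) (T d : nat) :
  (T%:R : R) `^ (d%:R / 2) = Num.sqrt T%:R ^+ d.
Proof.
by rewrite mulrC powRrM powR12_sqrt // powR_mulrn // sqrtr_ge0.
Qed.

Theorem theorem2p1 (R : realType) (d : nat) (d_ge1 : (1 <= d)%N) :
  exists c1 c2 : R, 0 < c1 /\ 0 < c2 /\
    forall T : nat, (1 <= T)%N ->
      c1 * (T%:R `^ (d%:R / 2)) <= (cop_number d T)%:R /\
      (cop_number d T)%:R <= c2 * (T%:R `^ (d%:R / 2)).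
Proof.
exists (2^-1 ^+ d), (27 ^+ d); rewrite !exprn_gt0 ?invr_gt0 //; do 2!split=> //.
move=> T T1; rewrite powR_half_nat -!exprMn; split.
  pose m := trunc_log 4 (3 * T + 1).
  have /andP[m_le m_gt] : (4 ^ m <= 3 * T + 1 < 4 ^ m.+1)%N.
    by apply: trunc_log_bounds; rewrite // addn1.
  have mT : (reserve m <= T)%N by rewrite -reserveE in m_le; lia.
  have := pow_le_cops (cop_numberP d T) mT.
  rewrite -(ler_nat R); apply: le_trans.
  rewrite mulnC expnM natrX lerXn2r ?nnegrE ?mulr_ge0 ?invr_ge0 ?sqrtr_ge0 //.
  rewrite ler_pdivrMl // -natrM -expnS.
  rewrite -(@ler_pXn2r _ 2) ?nnegrE ?sqrtr_ge0 //.
  rewrite sqr_sqrtr // -natrX ler_nat -expnM mulnC expnM.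
  by apply: (leq_trans _ (ltnW m_gt)); lia.
have [K [K2 KS]] := cops_suffice_sqrt d T1.
apply: (@le_trans _ _ (K ^ d)%:R); first by rewrite ler_nat cop_number_le.
rewrite natrX lerXn2r ?nnegrE ?mulr_ge0 ?sqrtr_ge0 //.
rewrite -(@ler_pXn2r _ 2) ?nnegrE ?mulr_ge0 ?sqrtr_ge0 //.
by rewrite exprMn sqr_sqrtr // -!natrX -natrM ler_nat.
Qed.
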